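(* For $1\le i\le 17$ let $C_i^{(\mathrm{Dege})}=V(Q^{(\mathrm{Dege})},P_i^{(\mathrm{Dege})})\subset\mathbb{P}^3$ be the superspecial curve of genus $4$ over $\mathbb{F}_{11}$ defined by $Q^{(\mathrm{Dege})}=2yw+z^2$ and the cubic form $P_i^{(\mathrm{Dege})}$ listed in the context, and write $A_i=\operatorname{Aut}_{\mathbb{F}_{11}}(C_i^{(\mathrm{Dege})})$. Then the following hold, where matrices over $\mathbb{F}_{11}$ denote the automorphisms they represent (modulo scalars). (1) $A_1$ has order $4$ and is generated by $\operatorname{diag}(1,1,-1,1)$ and $\begin{pmatrix}1&0&0&0\\0&0&0&1\\0&0&1&0\\0&1&0&0\end{pmatrix}$, whose orders are $2$ and $2$. (2) $A_2$ has order $4$ and is generated by $\operatorname{diag}(1,1,-1,1)$ and $\begin{pmatrix}1&0&0&0\\0&0&0&7\\0&0&1&0\\0&8&0&0\end{pmatrix}$, whose orders are $2$ and $2$. (3) $A_3$ has order $4$ and is generated by $\begin{pmatrix}1&0&0&0\\0&0&0&3\\0&0&1&0\\0&4&0&0\end{pmatrix}$ and $\begin{pmatrix}1&0&0&0\\0&7&4&2\\0&5&7&4\\0&10&5&7\end{pmatrix}$, whose orders are $2$ and $2$. (4) $A_4$ has order $2$ and is generated by $\operatorname{diag}(1,1,-1,1)$. (5) $A_5$ has order $2$ and is generated by $\operatorname{diag}(1,1,-1,1)$. (6) $A_6$ has order $1$. (7) $A_7$ has order $2$ and is generated by $\begin{pmatrix}1&0&0&0\\0&7&1&7\\0&9&7&1\\0&6&9&7\end{pmatrix}$.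 (8) $A_8$ has order $1$. (9) $A_9$ has order $6$ and is generated by $\begin{pmatrix}1&0&0&0\\0&6&5&8\\0&3&7&3\\0&2&4&7\end{pmatrix}$. (10) $A_{10}$ has order $12$ and is generated by $\begin{pmatrix}1&0&0&0\\0&2&9&10\\0&6&6&9\\0&2&6&2\end{pmatrix}$ and $\begin{pmatrix}1&0&0&0\\0&2&2&10\\0&6&5&9\\0&2&5&2\end{pmatrix}$, whose orders are $2$ and $6$ respectively. (11) $A_{11}$ has order $12$ and is generated by $\begin{pmatrix}1&0&0&0\\0&7&6&10\\0&8&9&6\\0&8&8&7\end{pmatrix}$ and $\begin{pmatrix}1&0&0&0\\0&2&1&8\\0&2&0&3\\0&10&6&7\end{pmatrix}$, whose orders are $2$ and $6$ respectively. (12) $A_{12}$ has order $24$ and is generated by $\begin{pmatrix}1&0&0&0\\0&1&9&9\\0&8&5&4\\0&1&6&4\end{pmatrix}$ and $\begin{pmatrix}1&0&0&0\\0&0&0&3\\0&0&1&0\\0&4&0&0\end{pmatrix}$, whose orders are $4$ and $2$ respectively. (13) $A_{13}$ has order $4$ and is generated by $\begin{pmatrix}1&0&0&0\\0&9&7&4\\0&1&1&0\\0&3&0&0\end{pmatrix}$. (14) $A_{14}$ has order $2$ and is generated by $\begin{pmatrix}1&0&0&0\\0&1&4&3\\0&10&8&4\\0&5&10&1\end{pmatrix}$. (15) $A_{15}$ has order $6$ and is generated by $\begin{pmatrix}1&0&0&0\\0&8&7&10\\0&5&2&3\\0&6&10&10\end{pmatrix}$. (16) $A_{16}$ has order $3$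 and is generated by $\begin{pmatrix}1&0&0&0\\0&1&8&1\\0&8&10&0\\0&1&0&0\end{pmatrix}$. (17) $A_{17}$ has order $8$ and is generated by $\begin{pmatrix}1&0&0&0\\0&3&6&5\\0&2&3&9\\0&3&3&4\end{pmatrix}$ and $\begin{pmatrix}1&0&0&0\\0&7&2&6\\0&2&9&2\\0&6&2&7\end{pmatrix}$, whose orders are $4$ and $2$ respectively.
   Context: The cubic forms in $\mathbb{F}_{11}[x,y,z,w]$ are: $P_1^{(\mathrm{Dege})}=x^3+y^3+w^3$, $P_2^{(\mathrm{Dege})}=x^3+y^3+2w^3$, $P_3^{(\mathrm{Dege})}=x^3+y^3+z^3+5w^3$, $P_4^{(\mathrm{Dege})}=x^3+xw^2+y^3$, $P_5^{(\mathrm{Dege})}=x^3+2xw^2+y^3$, $P_6^{(\mathrm{Dege})}=x^3+xzw+y^3+7z^3+w^3$, $P_7^{(\mathrm{Dege})}=x^3+xw^2+xyz+y^3+5z^3+4w^3$, $P_8^{(\mathrm{Dege})}=x^3+6xw^2+xyz+y^3+8z^3+8w^3$, $P_9^{(\mathrm{Dege})}=x^3+5y^3+2yz^2+z^3+zw^2+4w^3$, $P_{10}^{(\mathrm{Dege})}=x^3+y^3+8yz^2+z^2w+2w^3$, $P_{11}^{(\mathrm{Dege})}=x^3+2y^3+2yz^2+4z^3+z^2w+3w^3$, $P_{12}^{(\mathrm{Dege})}=x^3+2y^3+4yz^2+z^2w+10w^3$, $P_{13}^{(\mathrm{Dege})}=x^3+2y^3+4yz^2+z^3+z^2w+zw^2+7w^3$,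 $P_{14}^{(\mathrm{Dege})}=x^3+xy^2+7xyz+8xz^2+8xzw+2xw^2+2y^3+4yz^2+z^3+z^2w+zw^2+7w^3$, $P_{15}^{(\mathrm{Dege})}=x^3+5y^3+3yz^2+5z^3+z^2w+zw^2+10w^3$, $P_{16}^{(\mathrm{Dege})}=x^3+6y^3+2yz^2+6z^3+z^2w+zw^2+6w^3$, $P_{17}^{(\mathrm{Dege})}=x^3+10y^3+6yz^2+7z^3+z^2w+zw^2$. These curves are known to be nonsingular nonhyperelliptic superspecial curves of genus $4$ (canonically embedded). For $C=V(Q,P)$ over a field $K$, $\operatorname{Aut}_K(C)$ is the group of automorphisms of $C$ defined over $K$. It is described as $\operatorname{Aut}_K(C)=G_K/{\sim}$, where, with $\varphi$ the symmetric coefficient matrix of $Q$, $G_K=\{g\in \mathrm{GL}_4(K): {}^tg\varphi g=\mu\varphi\text{ for some }\mu\in K^\times,\ g\cdot P\equiv rP \bmod Q\text{ for some } r\in K^\times\}$, $g\cdot P:=P((x,y,z,w)\cdot{}^tg)$, and $g\sim cg$ for $c\in K^\times$. Generators are given by matrices representing classes in $G_K/{\sim}$, and orders are those of the classes. *)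

(* Defs.v *)
From HB Require Import structures.
From mathcomp Require Import all_boot all_order all_algebra all_fingroup.
From mathcomp Require Import mpoly boolp.

Set Implicit Arguments.
Unset Strict Implicit.
Unset Printing Implicit Defensive.

Import GRing.Theory.
Local Open Scope ring_scope.

Section Aut.
Variable F : finFieldType.
Implicit Types (Q P : {mpoly F[4]}) (M : 'M[F]_4) (g : {'GL_4[F]}).

(* [phi] with [Q = v *m phi *m v^T], [v = (x, y, z, w)]; needs [2 != 0] in [F]. *)
Definition sym_coef_mx Q : 'M[F]_4 :=
  \matrix_(i, j) (if i == j then Q@_(U_(i) + U_(j))
                  else Q@_(U_(i) + U_(j)) / 2%:R).

(* [P((x, y, z, w) *m M^T)]: the i-th variable becomes
   [\sum_j M i j * x_j]. *)
Definition act_mpoly M P : {mpoly F[4]} :=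
  P \mPo [tuple \sum_(j < 4) M i j *: 'X_j | i < 4].

Definition eq_mod Q P1 P2 : Prop := exists H : {mpoly F[4]}, P1 - P2 = H * Q.

Definition curve_stab Q P : {set {'GL_4[F]}} :=
  [set g : {'GL_4[F]} | `[< (exists2 mu : F, mu != 0 &
                  (GLval g)^T *m sym_coef_mx Q *m GLval g
                  = mu *: sym_coef_mx Q)
            /\ (exists2 r : F, r != 0 &
                  eq_mod Q (act_mpoly (GLval g) P) (r *: P)) >]].

Definition scalars : {set {'GL_4[F]}} :=
  [set g : {'GL_4[F]} | is_scalar_mx (GLval g)].

Lemma scalars_group_set : group_set scalars.
Proof.
apply/group_setP; split.
  rewrite inE GL_1E; exact: scalar_mx_is_scalar.
move=> g h; rewrite !inE GL_ME => /is_scalar_mxP[a ->] /is_scalar_mxP[b ->].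
by rewrite -[_ * _]/(_ *m _) -scalar_mxM scalar_mx_is_scalar.
Qed.
Canonical scalars_group := Group scalars_group_set.

Lemma norm_scalars : 'N(scalars)%g = [set: {'GL_4[F]}].
Proof.
apply/setP=> h; rewrite [RHS]inE; apply: (subsetP (cent_sub _)).
apply/centP=> g; rewrite inE => /is_scalar_mxP[a ga].
apply: val_inj; change (GLval h *m GLval g = GLval g *m GLval h); rewrite ga.
by rewrite scalar_mxC.
Qed.

(* [_ / scalars] is the image in the group [PGL_4(F)] of cosets of [scalars],
   by [norm_scalars]: every matrix has a class. *)
Definition curve_aut Q P : {set coset_of scalars} := (curve_stab Q P / scalars)%g.

Lemma curve_autE Q P : curve_aut Q P = coset scalars @: curve_stab Q P.
Proof.
rewrite /curve_aut /quotient morphimEsub //.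
by apply/subsetP=> g _; have: g \in 'N(scalars)%g by rewrite norm_scalars inE.
Qed.

Definition represents M (a : coset_of scalars) : Prop :=
  exists2 g : {'GL_4[F]}, GLval g = M & a = coset scalars g.

Definition mx4 (rows : seq (seq F)) : 'M[F]_4 :=
  \matrix_(i, j) (nth [::] rows i)`_j.

End Aut.

Local Notation x := ('X_(@Ordinal 4 0 isT) : {mpoly 'F_11[4]}).
Local Notation y := ('X_(@Ordinal 4 1 isT) : {mpoly 'F_11[4]}).
Local Notation z := ('X_(@Ordinal 4 2 isT) : {mpoly 'F_11[4]}).
Local Notation w := ('X_(@Ordinal 4 3 isT) : {mpoly 'F_11[4]}).

Definition Q_Dege : {mpoly 'F_11[4]} := 2 *: (y * w) + z ^+ 2.

Lemma sym_coef_mx_Dege :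
  sym_coef_mx Q_Dege =
  mx4 [:: [:: 0; 0; 0; 0]; [:: 0; 0; 0; 1]; [:: 0; 0; 1; 0]; [:: 0; 1; 0; 0]].
Proof.
apply/matrixP=> i j; rewrite !mxE /Q_Dege expr2 -!mpolyXD mcoeffD mcoeffZ !mcoeffX.
have mE (m1 m2 : 'X_{1..4}) : (m1 == m2) = [forall k : 'I_4, m1 k == m2 k].
  by apply/eqP/forallP => [-> //|H]; apply/mnmP=> k; apply/eqP.
have fE (p : pred 'I_4) : [forall k, p k] = 
    [&& p (@Ordinal 4 0 isT), p (@Ordinal 4 1 isT),
        p (@Ordinal 4 2 isT) & p (@Ordinal 4 3 isT)].
  apply/forallP/and4P=> [H|[a b c d] k]; first by split.
  case: k => [[|[|[|[|//]]]] lt].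
  - by rewrite (_ : Ordinal lt = @Ordinal 4 0 isT) //; apply/val_inj.
  - by rewrite (_ : Ordinal lt = @Ordinal 4 1 isT) //; apply/val_inj.
  - by rewrite (_ : Ordinal lt = @Ordinal 4 2 isT) //; apply/val_inj.
  - by rewrite (_ : Ordinal lt = @Ordinal 4 3 isT) //; apply/val_inj.
rewrite !mE !fE !mnmDE !mnm1E.
by case: i => [[|[|[|[|//]]]] ?];
  case: j => [[|[|[|[|//]]]] ?]; apply/val_inj; vm_compute.
Qed.

(* Only the indices 1 to 17 are meaningful. *)
Definition P_Dege (i : nat) : {mpoly 'F_11[4]} :=
  match i with
  | 1 => x ^+ 3 + y ^+ 3 + w ^+ 3
  | 2 => x ^+ 3 + y ^+ 3 + 2 *: w ^+ 3
  | 3 => x ^+ 3 + y ^+ 3 + z ^+ 3 + 5 *: w ^+ 3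
  | 4 => x ^+ 3 + x * w ^+ 2 + y ^+ 3
  | 5 => x ^+ 3 + 2 *: (x * w ^+ 2) + y ^+ 3
  | 6 => x ^+ 3 + x * z * w + y ^+ 3 + 7 *: z ^+ 3 + w ^+ 3
  | 7 => x ^+ 3 + x * w ^+ 2 + x * y * z + y ^+ 3 + 5 *: z ^+ 3 + 4 *: w ^+ 3
  | 8 => x ^+ 3 + 6 *: (x * w ^+ 2) + x * y * z + y ^+ 3 + 8 *: z ^+ 3
         + 8 *: w ^+ 3
  | 9 => x ^+ 3 + 5 *: y ^+ 3 + 2 *: (y * z ^+ 2) + z ^+ 3 + z * w ^+ 2
         + 4 *: w ^+ 3
  | 10 => x ^+ 3 + y ^+ 3 + 8 *: (y * z ^+ 2) + z ^+ 2 * w + 2 *: w ^+ 3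
  | 11 => x ^+ 3 + 2 *: y ^+ 3 + 2 *: (y * z ^+ 2) + 4 *: z ^+ 3 + z ^+ 2 * w
          + 3 *: w ^+ 3
  | 12 => x ^+ 3 + 2 *: y ^+ 3 + 4 *: (y * z ^+ 2) + z ^+ 2 * w + 10 *: w ^+ 3
  | 13 => x ^+ 3 + 2 *: y ^+ 3 + 4 *: (y * z ^+ 2) + z ^+ 3 + z ^+ 2 * w
          + z * w ^+ 2 + 7 *: w ^+ 3
  | 14 => x ^+ 3 + x * y ^+ 2 + 7 *: (x * y * z) + 8 *: (x * z ^+ 2)
          + 8 *: (x * z * w) + 2 *: (x * w ^+ 2) + 2 *: y ^+ 3
          + 4 *: (y * z ^+ 2) + z ^+ 3 + z ^+ 2 * w + z * w ^+ 2 + 7 *: w ^+ 3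
  | 15 => x ^+ 3 + 5 *: y ^+ 3 + 3 *: (y * z ^+ 2) + 5 *: z ^+ 3 + z ^+ 2 * w
          + z * w ^+ 2 + 10 *: w ^+ 3
  | 16 => x ^+ 3 + 6 *: y ^+ 3 + 2 *: (y * z ^+ 2) + 6 *: z ^+ 3 + z ^+ 2 * w
          + z * w ^+ 2 + 6 *: w ^+ 3
  | 17 => x ^+ 3 + 10 *: y ^+ 3 + 6 *: (y * z ^+ 2) + 7 *: z ^+ 3 + z ^+ 2 * w
          + z * w ^+ 2
  | _ => 0
  end.

Definition A_Dege (i : nat) : {set coset_of (scalars 'F_11)} :=
  curve_aut Q_Dege (P_Dege i).

(* Main.v *)
Require Import Defs.
From HB Require Import structures.
From Stdlib Require Import NArith Lia.
From mathcomp Require Import all_boot all_order all_algebra all_fingroup.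
From mathcomp Require Import cyclic mpoly boolp ring.

(* The form [Q = 2yw + z^2] does not involve [x], so a matrix [g] preserving it
   up to a factor is block triangular, and since each [P_i = x^3 + x L + C] has
   no [x^2] term, [g] is a scalar multiple of [1 (+) B] with [B] a similitude
   of the ternary form such that [L] and [C] are [B]-invariant modulo [Q].
   Comparing values at three points of the conic [Q(y,z,w) = 0] leaves few
   possible images for each of them, and these images determine [B]: a finite
   enumeration then shows that every such [B] lies in the closure of the given
   generators.  Conversely each matrix of the closure is seen to stabilise the
   curve by comparing the normal forms of [L], [C] and of their transforms
   modulo [z^2 = -2yw]. *)

Set Implicit Arguments.
Unset Strict Implicit.
Unset Printing Implicit Defensive.

Import GRing.Theory.
Local Open Scope ring_scope.

(** * Arithmetic modulo 11 *)

Definition vec (K : Type) := (K * K * K)%type.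
Definition coord K (v : vec K) (i : nat) : K :=
  match i with 0 => v.1.1 | 1 => v.1.2 | _ => v.2 end.
Definition mapv K K' (f : K -> K') (v : vec K) : vec K' :=
  (f v.1.1, f v.1.2, f v.2).

Lemma coord_mapv K K' (f : K -> K') v i : coord (mapv f v) i = f (coord v i).
Proof. by case: i => [|[|i]]. Qed.

(* [(c, i, j)] is the monomial [c v_i v_j] in [v = (y, z, w)], and similarly
   for cubic forms. *)
Definition qform := seq (N * nat * nat).
Definition cform := seq (N * nat * nat * nat).

(** Coefficients are binary numbers so that [vm_compute] can run the enumeration. Reading them in an
    arbitrary ring serves both ['F_11] and the polynomial ring. *)
Definition ofN (R : nzRingType) (n : N) : R := (N.to_nat n)%:R.

Section OfN.
Variable R : nzRingType.

Lemma ofND m n : ofN R (m + n)%num = ofN R m + ofN R n.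
Proof. by rewrite /ofN N2Nat.inj_add natrD. Qed.

Lemma ofNM m n : ofN R (m * n)%num = ofN R m * ofN R n.
Proof. by rewrite /ofN N2Nat.inj_mul natrM. Qed.

Lemma rmorph_ofN (S : nzRingType) (f : {rmorphism R -> S}) n :
  f (ofN R n) = ofN S n.
Proof. exact: rmorph_nat. Qed.

Definition red (n : N) : N := N.modulo n 11.

Lemma ofN_red n : 11%:R = 0 :> R -> ofN R (red n) = ofN R n.
Proof.
move=> R11; rewrite [in RHS](N.div_mod n 11) // ofND ofNM.
by rewrite [ofN R 11]R11 mul0r add0r.
Qed.

End OfN.

Section Eval.
Variable R : comNzRingType.

(** The ring is left abstract: at the indeterminates the value is the form itself, while
    substitution of variables and evaluation at a point are both ring morphisms, to which
    [rmorph_qeval] and [rmorph_ceval] apply. *)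
Definition qeval (f : qform) (v : vec R) : R :=
  \sum_(m <- f) ofN R m.1.1 * (coord v m.1.2 * coord v m.2).
Definition ceval (f : cform) (v : vec R) : R :=
  \sum_(m <- f) ofN R m.1.1.1 *
                (coord v m.1.1.2 * coord v m.1.2 * coord v m.2).

End Eval.

Lemma rmorph_qeval (R S : comNzRingType) (f : {rmorphism R -> S}) q v :
  f (qeval q v) = qeval q (mapv f v).
Proof.
rewrite rmorph_sum; apply: eq_bigr => m _.
by rewrite !rmorphM rmorph_ofN /= !coord_mapv.
Qed.

Lemma rmorph_ceval (R S : comNzRingType) (f : {rmorphism R -> S}) q v :
  f (ceval q v) = ceval q (mapv f v).
Proof.
rewrite rmorph_sum; apply: eq_bigr => m _.
by rewrite !rmorphM rmorph_ofN /= !coord_mapv.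
Qed.

Definition vecN := vec N.
Definition qevalN (f : qform) (v : vecN) : N :=
  red (foldr (fun m s => m.1.1 * (coord v m.1.2 * coord v m.2) + s)%num 0%num f).
Definition cevalN (f : cform) (v : vecN) : N :=
  red (foldr (fun m s => m.1.1.1 *
    (coord v m.1.1.2 * coord v m.1.2 * coord v m.2) + s)%num 0%num f).

(* A matrix is the triple of its columns. *)
Definition matN := vec vecN.
Definition rowN (t : matN) i : vecN := mapv (fun c => coord c i) t.
Definition dotN (u v : vecN) : N :=
  red (u.1.1 * v.1.1 + (u.1.2 * v.1.2 + u.2 * v.2))%num.
Definition applyN (t : matN) (v : vecN) : vecN :=
  (dotN (rowN t 0) v, dotN (rowN t 1) v, dotN (rowN t 2) v).
Definition mulN (s t : matN) : matN := mapv (applyN s) t.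
Definition oneN : matN := ((1, 0, 0), (0, 1, 0), (0, 0, 1))%num.

(** This is the symmetric bilinear form of [2yw + z^2]: the value of that form at [v] is
    [bilN v v]. *)
Definition bilN (u v : vecN) : N :=
  red (u.1.1 * v.2 + (u.1.2 * v.1.2 + u.2 * v.1.1))%num.

(** The Gram matrix of the columns has to be [mu] times the antidiagonal matrix of ones; by symmetry
    six of its entries decide. *)
Definition simil (t : matN) : bool :=
  let c0 := t.1.1 in let c1 := t.1.2 in let c2 := t.2 in
  let mu := bilN c0 c2 in
  [&& mu != 0%num, bilN c0 c0 == 0%num, bilN c2 c2 == 0%num,
      bilN c0 c1 == 0%num, bilN c1 c2 == 0%num & bilN c1 c1 == mu].

(* Coefficients of quadratic and cubic forms reduced by [z^2 = -2yw], in the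
   bases [y^2, yz, yw, zw, w^2] and [y^3, y^2z, y^2w, yzw, yw^2, zw^2, w^3];
   the [9] below is [-2]. *)
Definition quadN := (N * N * N * N * N)%type.
Definition cubN := (N * N * N * N * N * N * N)%type.

Definition lmulN (l m : vecN) : quadN :=
  let: (l0, l1, l2) := l in let: (m0, m1, m2) := m in
  (l0 * m0, l0 * m1 + l1 * m0, l0 * m2 + 9 * (l1 * m1) + l2 * m0,
   l1 * m2 + l2 * m1, l2 * m2)%num.

Definition qmulN (q : quadN) (l : vecN) : cubN :=
  let: (q0, q1, q2, q3, q4) := q in let: (l0, l1, l2) := l in
  (q0 * l0, q0 * l1 + q1 * l0, q0 * l2 + 9 * (q1 * l1) + q2 * l0,
   q1 * l2 + q2 * l1 + q3 * l0, q2 * l2 + 9 * (q3 * l1) + q4 * l0,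
   q3 * l2 + q4 * l1, q4 * l2)%num.

Definition axpy5 (c : N) (p q : quadN) : quadN :=
  let: (p0, p1, p2, p3, p4) := p in let: (q0, q1, q2, q3, q4) := q in
  (red (c * p0 + q0), red (c * p1 + q1), red (c * p2 + q2),
   red (c * p3 + q3), red (c * p4 + q4))%num.

Definition axpy7 (c : N) (p q : cubN) : cubN :=
  let: (p0, p1, p2, p3, p4, p5, p6) := p in
  let: (q0, q1, q2, q3, q4, q5, q6) := q in
  (red (c * p0 + q0), red (c * p1 + q1), red (c * p2 + q2),
   red (c * p3 + q3), red (c * p4 + q4), red (c * p5 + q5),
   red (c * p6 + q6))%num.

Definition qnf (f : qform) (t : matN) : quadN :=
  foldr (fun m s => axpy5 m.1.1 (lmulN (rowN t m.1.2) (rowN t m.2)) s)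
        (0, 0, 0, 0, 0)%num f.
Definition cnf (f : cform) (t : matN) : cubN :=
  foldr (fun m s => axpy7 m.1.1.1
    (qmulN (lmulN (rowN t m.1.1.2) (rowN t m.1.2)) (rowN t m.2)) s)
        (0, 0, 0, 0, 0, 0, 0)%num f.

(** A sufficient test: since [x] is fixed, it is enough that [L] and [C] are each preserved modulo
    [Q], which equality of normal forms shows. *)
Definition stabN (L : qform) (C : cform) (t : matN) : bool :=
  [&& simil t, qnf L t == qnf L oneN & cnf C t == cnf C oneN].

(** * Enumeration of candidates and closure of the generators *)

Definition digits : seq N := [:: 0; 1; 2; 3; 4; 5; 6; 7; 8; 9; 10]%num.

Definition isotropic : seq vecN :=
  [seq v <- [seq (p, c) | p <- [seq (a, b) | a <- digits, b <- digits], c <- digits]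
     | bilN v v == 0%num].

(** The possible images of a point [p] of the conic: a stabilising block sends it to an isotropic
    vector with the same values of [L] and [C]. *)
Definition fiber (L : qform) (C : cform) (p : vecN) : seq vecN :=
  [seq v <- isotropic | (qevalN L v == qevalN L p) && (cevalN C v == cevalN C p)].

(** One vector for each of the twelve points of the conic over ['F_11]. The factor [5] is [-1/2]
    modulo 11, which solves [2w + z^2 = 0] for [w]. *)
Definition conic : seq vecN :=
  (0, 0, 1)%num :: [seq (1, z, red (5 * (z * z)))%num | z <- digits].

(* The middle column is [u - c0 - 5 c2] when [u] is the image of [(1, 1, 5)]. *)
Definition of_three_images (c0 u c2 : vecN) : matN :=
  (c0, (red (u.1.1 + (10 * c0.1.1 + 6 * c2.1.1)),
        red (u.1.2 + (10 * c0.1.2 + 6 * c2.1.2)),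
        red (u.2 + (10 * c0.2 + 6 * c2.2))), c2)%num.

Definition keeps_valuesN (L : qform) (C : cform) (t : matN) : bool :=
  simil t && all (fun p => let v := applyN t p in
    (qevalN L v == qevalN L p) && (cevalN C v == cevalN C p)) conic.

(** A block is determined by the images of the isotropic basis [(1, 0, 0)], [(1, 1, 5)],
    [(0, 0, 1)]. The product [bilN cc.1 cc.2] is the similitude factor, so pairs where it vanishes
    are dropped before the third image is chosen. *)
Definition candidates (L : qform) (C : cform) : seq matN :=
  let s1 := fiber L C (1, 1, 5)%num in
  [seq t <- flatten [seq [seq of_three_images cc.1 u cc.2 | u <- s1]
                    | cc <- [seq (c0, c2) | c0 <- fiber L C (1, 0, 0)%num,
                                            c2 <- fiber L C (0, 0, 1)%num]
                    & bilN cc.1 cc.2 != 0%num]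
   | keeps_valuesN L C t].

(** Products by generators suffice to reach the whole group: in a finite group inverses are
    powers. *)
Definition step (gs s : seq matN) : seq matN :=
  undup (s ++ [seq mulN g t | g <- gs, t <- s]).
(* Eight rounds reach the whole group for all 17 curves. *)
Definition generated (gs : seq matN) : seq matN :=
  iter 8 (step gs) [:: oneN].

(** With reduced entries, equal matrices over ['F_11] are equal tables; this is what makes the
    length of a duplicate-free list a group order. *)
Definition canonical (t : matN) : bool := mapv (mapv red) t == t.

(** A certificate for both inclusions: [stabN] puts the closure inside the stabiliser, and the last
    test puts every candidate block inside the closure. Stability under products turns the finite
    set of classes into a group. *)
Definition stabiliser_check (L : qform) (C : cform) (gs : seq matN) (n : nat) : bool :=
  let s := generated gs in
  [&& size s == n, oneN \in s, all (fun g => g \in s) gs, all (stabN L C) s,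
      all canonical s, all (fun t => all (fun u => mulN t u \in s) s) s
    & all (fun t => t \in s) (candidates L C)].

Definition powN (t : matN) (k : nat) : matN := iter k (mulN t) oneN.
Definition orderN (t : matN) (k : nat) : bool :=
  [&& (0 < k)%N, powN t k == oneN & all (fun j => powN t j != oneN) (iota 1 k.-1)].

Local Notation F := 'F_11.
Local Notation MP := {mpoly 'F_11[4]}.

Lemma F11_eq0 : 11%:R = 0 :> F.
Proof. exact/val_inj. Qed.

Lemma mpolyF11_eq0 : 11%:R = 0 :> MP.
Proof. by rewrite -mpolyC_nat F11_eq0 mpolyC0. Qed.

Local Notation v0 := (@Ordinal 3 0 isT).
Local Notation v1 := (@Ordinal 3 1 isT).
Local Notation v2 := (@Ordinal 3 2 isT).

Lemma forall_ord3 (P : 'I_3 -> Prop) : P v0 -> P v1 -> P v2 -> forall i, P i.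
Proof.
move=> P0 P1 P2 [[|[|[|//]]] lt3].
- by rewrite (_ : Ordinal lt3 = v0) //; apply: val_inj.
- by rewrite (_ : Ordinal lt3 = v1) //; apply: val_inj.
- by rewrite (_ : Ordinal lt3 = v2) //; apply: val_inj.
Qed.

Lemma sum_ord3 (V : nmodType) (f : 'I_3 -> V) :
  \sum_i f i = f v0 + (f v1 + f v2).
Proof.
rewrite !big_ord_recl big_ord0 addr0.
by congr (f _ + (f _ + f _)); apply: val_inj.
Qed.

(** * Normal forms modulo the conic *)

Definition vars : vec MP :=
  ('X_(@Ordinal 4 1 isT), 'X_(@Ordinal 4 2 isT), 'X_(@Ordinal 4 3 isT)).
Definition X0 : MP := 'X_(@Ordinal 4 0 isT).

Definition cubic_form (L : qform) (C : cform) : MP :=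
  X0 ^+ 3 + X0 * qeval L vars + ceval C vars.

Section NormalForm.

Local Arguments N.add : simpl never.
Local Arguments N.mul : simpl never.

Local Notation y := vars.1.1.
Local Notation z := vars.1.2.
Local Notation w := vars.2.
Local Notation c := (ofN MP).

Definition lin (l : vecN) : MP := c l.1.1 * y + c l.1.2 * z + c l.2 * w.
Definition quad (q : quadN) : MP :=
  let: (q0, q1, q2, q3, q4) := q in
  c q0 * y ^+ 2 + c q1 * (y * z) + c q2 * (y * w) + c q3 * (z * w)
  + c q4 * w ^+ 2.
Definition cub (q : cubN) : MP :=
  let: (q0, q1, q2, q3, q4, q5, q6) := q in
  c q0 * y ^+ 3 + c q1 * (y ^+ 2 * z) + c q2 * (y ^+ 2 * w)
  + c q3 * (y * z * w) + c q4 * (y * w ^+ 2) + c q5 * (z * w ^+ 2)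
  + c q6 * w ^+ 3.

Lemma Q_DegeE : Q_Dege = 2%:R * (y * w) + z ^+ 2.
Proof. by rewrite /Q_Dege scaler_nat mulr_natl. Qed.

Local Notation "p == q" := (eq_mod Q_Dege p q).

Lemma eq_mod_refl p : p == p.
Proof. by exists 0; rewrite subrr mul0r. Qed.

Lemma eq_mod_sym p q : p == q -> q == p.
Proof. by case=> H e; exists (- H); rewrite mulNr -e opprB. Qed.

Lemma eq_mod_trans q p r : p == q -> q == r -> p == r.
Proof.
by case=> H1 e1 [H2 e2]; exists (H1 + H2); rewrite mulrDl -e1 -e2; ring.
Qed.

Lemma eq_modD p q p' q' : p == q -> p' == q' -> p + p' == q + q'.
Proof.
by case=> H1 e1 [H2 e2]; exists (H1 + H2); rewrite mulrDl -e1 -e2; ring.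
Qed.

Lemma eq_modM r p q : p == q -> r * p == r * q.
Proof. by case=> H e; exists (r * H); rewrite -mulrA -e; ring. Qed.

Lemma eq_modMr r p q : p == q -> p * r == q * r.
Proof. by rewrite ![_ * r]mulrC; apply: eq_modM. Qed.

Lemma lin_mul l m : lin l * lin m == quad (lmulN l m).
Proof.
(* Only [z^2] has to be reduced; its coefficient [l1 m1] is the multiple of [Q] to subtract. *)
case: l m => [[l0 l1] l2] [[m0 m1] m2]; exists (c l1 * c m1).
rewrite Q_DegeE /lin /quad /= !(ofND, ofNM).
have -> : c 9 = 11%:R - 2%:R by apply/eqP; rewrite eq_sym subr_eq -natrD.
by rewrite mpolyF11_eq0; ring.
Qed.

Lemma quad_lin_mul q l : quad q * lin l == cub (qmulN q l).
Proof.
case: q l => [[[[q0 q1] q2] q3] q4] [[l0 l1] l2].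
(* The monomials containing [z^2] are [y z^2], from [yz] times [z], and [z^2 w], from [zw] times
   [z]. *)
exists (c q1 * c l1 * y + c q3 * c l1 * w).
rewrite Q_DegeE /lin /quad /cub /= !(ofND, ofNM).
have -> : c 9 = 11%:R - 2%:R by apply/eqP; rewrite eq_sym subr_eq -natrD.
by rewrite mpolyF11_eq0; ring.
Qed.

Lemma quad_axpy a p q : quad (axpy5 a p q) = c a * quad p + quad q.
Proof.
case: p q => [[[[p0 p1] p2] p3] p4] [[[[q0 q1] q2] q3] q4] /=.
by rewrite !ofN_red ?mpolyF11_eq0 // !(ofND, ofNM); ring.
Qed.

Lemma cub_axpy a p q : cub (axpy7 a p q) = c a * cub p + cub q.
Proof.
case: p q => [[[[[[p0 p1] p2] p3] p4] p5] p6] [[[[[[q0 q1] q2] q3] q4] q5] q6].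
by rewrite /= !ofN_red ?mpolyF11_eq0 // !(ofND, ofNM); ring.
Qed.

Definition images (t : matN) : vec MP :=
  (lin (rowN t 0), lin (rowN t 1), lin (rowN t 2)).

Lemma coord_rowN t i k : coord (rowN t i) k = coord (coord t k) i.
Proof. by rewrite coord_mapv. Qed.

Lemma coord_images t i : coord (images t) i = lin (rowN t i).
Proof. by case: i => [|[|i]] //; rewrite /lin /rowN /=. Qed.

Lemma qeval_images f t : qeval f (images t) == quad (qnf f t).
Proof.
elim: f => [|m f IH].
  rewrite /qeval big_nil /= /ofN !mul0r !addr0; exact: eq_mod_refl.
rewrite /qeval big_cons.
rewrite -[qnf _ _]/(axpy5 m.1.1 (lmulN (rowN t m.1.2) (rowN t m.2)) (qnf f t)).
rewrite quad_axpy; apply: eq_modD (IH).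
by rewrite !coord_images; apply/eq_modM/lin_mul.
Qed.

Lemma ceval_images f t : ceval f (images t) == cub (cnf f t).
Proof.
elim: f => [|m f IH].
  rewrite /ceval big_nil /= /ofN !mul0r !addr0; exact: eq_mod_refl.
rewrite /ceval big_cons.
rewrite -[cnf _ _]/(axpy7 m.1.1.1
  (qmulN (lmulN (rowN t m.1.1.2) (rowN t m.1.2)) (rowN t m.2)) (cnf f t)).
rewrite cub_axpy; apply: eq_modD (IH).
rewrite !coord_images; apply/eq_modM.
apply: eq_mod_trans (quad_lin_mul _ _); exact/eq_modMr/lin_mul.
Qed.

Lemma images1 : images oneN = vars.
Proof.
have c1 : c 1 = 1 by [].
have c0 : c 0 = 0 by [].
by rewrite /images /lin /rowN /= c1 c0 !(mul0r, mul1r, addr0, add0r).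
Qed.

Lemma cubic_form_images L C t :
  qnf L t = qnf L oneN -> cnf C t = cnf C oneN ->
  X0 ^+ 3 + X0 * qeval L (images t) + ceval C (images t) == cubic_form L C.
Proof.
(* The original form is read as its own transform by the identity, so both sides reduce to the same
   normal forms. *)
move=> eL eC; rewrite /cubic_form -images1; apply: eq_modD.
  apply: eq_modD (eq_mod_refl _) _; apply: eq_modM.
  by apply: eq_mod_trans (qeval_images _ _) _; rewrite eL; apply/eq_mod_sym/qeval_images.
by apply: eq_mod_trans (ceval_images _ _) _; rewrite eC; apply/eq_mod_sym/ceval_images.
Qed.

End NormalForm.

(** * Matrices and similitudes *)

Definition mx3 (t : matN) : 'M[F]_3 :=
  \matrix_(i, j) ofN F (coord (coord t j) i).

Lemma act_mpoly_X (M : 'M[F]_4) i :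
  act_mpoly M 'X_i = \sum_(j < 4) M i j *: 'X_j.
Proof. by rewrite /act_mpoly comp_mpolyXU -tnth_nth tnth_mktuple. Qed.

Lemma lift0_mx_row (B : 'M[F]_3) (i : 'I_3) :
  \sum_(j < 4) (lift0_mx B : 'M_4) (rshift 1 i) j *: 'X_j =
  \sum_(j < 3) B i j *: 'X_(rshift 1 j : 'I_4) :> MP.
Proof.
rewrite (@big_split_ord _ _ _ 1 3) /= big_ord1.
rewrite /lift0_mx (@block_mxEdl _ 1 3 1 3) mxE scale0r add0r.
by apply: eq_bigr => j _; rewrite (@block_mxEdr _ 1 3 1 3).
Qed.

Lemma scaler_ofN n (p : MP) : ofN F n *: p = ofN MP n * p.
Proof. by rewrite /ofN scaler_nat mulr_natl. Qed.

Lemma act_mpoly_var t (k : 'I_3) :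
  act_mpoly (lift0_mx (mx3 t)) 'X_(rshift 1 k : 'I_4) = lin (rowN t k).
Proof.
rewrite act_mpoly_X lift0_mx_row sum_ord3 !mxE !scaler_ofN /lin.
rewrite -!coord_rowN /= addrA.
by congr (_ * _ + _ * _ + _ * _); congr 'X_(_); apply: val_inj.
Qed.

Lemma act_mpoly_X0 (B : 'M[F]_3) : act_mpoly (lift0_mx B) X0 = X0.
Proof.
rewrite /X0 act_mpoly_X (@big_split_ord _ _ _ 1 3) /= big_ord1 big1 ?addr0.
  rewrite (_ : @Ordinal 4 0 isT = lshift 3 (0 : 'I_1)); last exact/val_inj.
  by rewrite /lift0_mx (@block_mxEul _ 1 3 1 3) mxE scale1r.
move=> j _; rewrite (_ : @Ordinal 4 0 isT = lshift 3 (0 : 'I_1)); last exact/val_inj.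
by rewrite /lift0_mx (@block_mxEur _ 1 3 1 3) mxE scale0r.
Qed.

Lemma act_mpoly_cubic_form L C t :
  act_mpoly (lift0_mx (mx3 t)) (cubic_form L C) =
  X0 ^+ 3 + X0 * qeval L (images t) + ceval C (images t).
Proof.
(* Substitution is packaged as a ring morphism; it is then enough to know its effect on [x] and on
   the triple [vars]. *)
pose f : {rmorphism MP -> MP} := comp_mpoly
  [tuple \sum_(j < 4) (lift0_mx (mx3 t) : 'M_4) i j *: 'X_j | i < 4].
have fX0 : f X0 = X0 by exact: act_mpoly_X0.
have fvars : mapv f vars = images t.
  have fk (k : 'I_3) : f 'X_(rshift 1 k : 'I_4) = lin (rowN t k).
    exact: act_mpoly_var.
  by rewrite /mapv /images -(fk v0) -(fk v1) -(fk v2) /vars /=;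
     congr (f 'X_(_), f 'X_(_), f 'X_(_)); apply: val_inj.
rewrite -[LHS]/(f _) /cubic_form !(rmorphD, rmorphM, rmorphXn) /= fX0.
by rewrite -[comp_mpoly _]/(GRing.RMorphism.sort f) rmorph_qeval rmorph_ceval fvars.
Qed.

Definition bil (u v : vec F) : F := u.1.1 * v.2 + (u.1.2 * v.1.2 + u.2 * v.1.1).

(** The antidiagonal matrix of ones, which is the matrix of [2yw + z^2] in [(y, z, w)]. *)
Definition phi3 : 'M[F]_3 := \matrix_(i, j) ((i + j)%N == 2%N)%:R.
Definition colv (B : 'M[F]_3) j : vec F := (B v0 j, B v1 j, B v2 j).

(** This turns the matrix equation of similitudes into the products of columns tested by [simil]. *)
Lemma conj_phi3 (B D : 'M[F]_3) i j :
  (B^T *m phi3 *m D) i j = bil (colv B i) (colv D j).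
Proof.
rewrite !mxE sum_ord3 !mxE !sum_ord3 !mxE /= /bil /=; ring.
Qed.

Lemma sym_coef_mx_block :
  sym_coef_mx Q_Dege = block_mx (0 : 'M_1) 0 0 phi3 :> 'M_(1 + 3).
Proof.
rewrite sym_coef_mx_Dege; apply/matrixP=> i j.
rewrite /mx4 /phi3 /block_mx !mxE.
case: split_ordP => i' ->; rewrite !mxE; case: split_ordP => j' ->; rewrite !mxE //.
- by rewrite !ord1.
- by rewrite !ord1; move: j'; apply: forall_ord3.
- by rewrite !ord1; move: i'; apply: forall_ord3.
- by move: i' j'; apply: forall_ord3; apply: forall_ord3.
Qed.

(** * Transfer between computed residues and the field *)

Lemma bil_ofN u v :
  bil (mapv (ofN F) u) (mapv (ofN F) v) = ofN F (bilN u v).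
Proof. by rewrite /bilN ofN_red ?F11_eq0 // !(ofND, ofNM). Qed.

Lemma colv_mx3 t j : colv (mx3 t) j = mapv (ofN F) (coord t j).
Proof. by rewrite /colv !mxE. Qed.

Lemma red_lt n : (N.to_nat (red n) < 11)%N.
Proof.
have lt11 : N.lt (red n) 11 by apply: N.mod_lt.
by apply/ltP; lia.
Qed.

Lemma Fp11_val k : (k < 11)%N -> val (k%:R : F) = k.
Proof. by move=> k_lt; rewrite /= val_Fp_nat // modn_small. Qed.

(** Residues below 11 embed into the field, so boolean tests on [N] decide equalities in [F]. *)
Lemma eq_ofN m n : (red m == red n) = (ofN F m == ofN F n).
Proof.
apply/eqP/eqP=> [e|]; first by rewrite -ofN_red ?F11_eq0 // e ofN_red ?F11_eq0.
rewrite -(ofN_red m F11_eq0) -(ofN_red n F11_eq0) => /(congr1 val).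
by rewrite /ofN !Fp11_val ?red_lt // => /N2Nat.inj.
Qed.

Lemma red_red n : red (red n) = red n.
Proof. by apply/eqP; rewrite eq_ofN ofN_red ?F11_eq0. Qed.

Definition toN (a : F) : N := red (N.of_nat (val a)).

Lemma toNK a : ofN F (toN a) = a.
Proof.
rewrite ofN_red ?F11_eq0 // /ofN Nat2N.id; apply: val_inj.
by rewrite /= val_Fp_nat // modn_small //; case: a.
Qed.

Lemma red_toN a : red (toN a) = toN a.
Proof. exact: red_red. Qed.

Lemma mapv_toNK v : mapv (ofN F) (mapv toN v) = v.
Proof. by case: v => [[a b] c]; rewrite /mapv /= !toNK. Qed.

Lemma ofN_qeval f v : ofN F (qevalN f v) = qeval f (mapv (ofN F) v).
Proof.
rewrite /qevalN ofN_red ?F11_eq0 // /qeval; elim: f => [|m f IH]; first by rewrite big_nil.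
by rewrite big_cons /= ofND !ofNM IH !coord_mapv.
Qed.

Lemma ofN_ceval f v : ofN F (cevalN f v) = ceval f (mapv (ofN F) v).
Proof.
rewrite /cevalN ofN_red ?F11_eq0 // /ceval; elim: f => [|m f IH]; first by rewrite big_nil.
by rewrite big_cons /= ofND !ofNM IH !coord_mapv.
Qed.

Lemma ofN_dot u v : ofN F (dotN u v) =
  ofN F u.1.1 * ofN F v.1.1 + (ofN F u.1.2 * ofN F v.1.2 + ofN F u.2 * ofN F v.2).
Proof. by rewrite /dotN ofN_red ?F11_eq0 // !(ofND, ofNM). Qed.

Definition applyF (B : 'M[F]_3) (p : vec F) : vec F :=
  let r i := B i v0 * p.1.1 + (B i v1 * p.1.2 + B i v2 * p.2) in
  (r v0, r v1, r v2).

Lemma ofN_applyN t p :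
  mapv (ofN F) (applyN t p) = applyF (mx3 t) (mapv (ofN F) p).
Proof.
rewrite /mapv /applyF /= !ofN_dot.
by congr (_, _, _); rewrite !mxE.
Qed.

Lemma mx3_mul s t : mx3 (mulN s t) = mx3 s *m mx3 t.
Proof.
apply/matrixP=> i j; rewrite !mxE sum_ord3 !mxE /mulN coord_mapv.
by move: i; apply: forall_ord3; rewrite /= ofN_dot.
Qed.

Lemma mx3_1 : mx3 oneN = 1%:M.
Proof.
by apply/matrixP=> i j; move: i j; apply: forall_ord3; apply: forall_ord3; rewrite !mxE.
Qed.

Lemma phi3_unit : phi3 \in unitmx.
Proof.
have/mulmx1_unit[] // : phi3 *m phi3 = 1%:M.
by apply/matrixP=> i j; move: i j; apply: forall_ord3; apply: forall_ord3;
   rewrite !mxE sum_ord3 !mxE; apply: val_inj.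
Qed.

Lemma simil_unitmx (B : 'M[F]_3) mu :
  mu != 0 -> B^T *m phi3 *m B = mu *: phi3 -> B \in unitmx.
Proof.
move=> mu0 e; have : mu *: phi3 \in unitmx by rewrite unitmxZ ?unitfE ?phi3_unit.
by rewrite -e unitmx_mul => /andP[].
Qed.

Lemma eq_bilN u v u' v' : (bilN u v == bilN u' v') =
  (bil (mapv (ofN F) u) (mapv (ofN F) v) ==
   bil (mapv (ofN F) u') (mapv (ofN F) v')).
Proof. by rewrite !bil_ofN -eq_ofN /bilN !red_red. Qed.

Lemma bil_sym u v : bil u v = bil v u.
Proof. by rewrite /bil; ring. Qed.

Lemma bilN_eq0 u v : (bilN u v == 0%num) =
  (bil (mapv (ofN F) u) (mapv (ofN F) v) == 0).
Proof. by rewrite bil_ofN -[0]/(ofN F 0) -eq_ofN /bilN red_red. Qed.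

Lemma phi3E i j : phi3 i j = ((i + j)%N == 2%N)%:R.
Proof. by rewrite mxE. Qed.

Lemma similP t :
  reflect (exists2 mu, mu != 0 & (mx3 t)^T *m phi3 *m mx3 t = mu *: phi3)
          (simil t).
Proof.
rewrite /simil !bilN_eq0 eq_bilN.
have E i j : ((mx3 t)^T *m phi3 *m mx3 t) i j =
    bil (mapv (ofN F) (coord t i)) (mapv (ofN F) (coord t j)).
  by rewrite conj_phi3 !colv_mx3.
apply: (iffP and5P) => [[mu0 /eqP e00 /eqP e22 /eqP e01]|[mu mu0 e]].
  case/andP=> /eqP e12 /eqP e11; exists (bil (mapv (ofN F) t.1.1) (mapv (ofN F) t.2)) => //.
  apply/matrixP=> i j; rewrite E !mxE; move: i j.
  by apply: forall_ord3; apply: forall_ord3 => /=;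
    rewrite ?(mulr0, mulr1) // bil_sym.
have {}E (i j : 'I_3) : bil (mapv (ofN F) (coord t i)) (mapv (ofN F) (coord t j)) = mu * phi3 i j.
  by rewrite -E e mxE.
have := (E v0 v2, E v0 v0, E v2 v2, E v0 v1, E v1 v2, E v1 v1).
rewrite !phi3E /= => -[[[[[-> ->] ->] ->] ->] ->].
by rewrite !mulr0 mulr1 !eqxx.
Qed.

(** * Classes of matrices modulo scalars *)

Section ClassOfMatrix.
Variable K : finFieldType.
Implicit Types A B : 'M[K]_4.

(** The default value [1] at singular matrices makes [class] a total function on matrices. *)
Definition toGL A : {'GL_4[K]} := insubd (1%g : {'GL_4[K]}) A.

Lemma toGLE A : A \in unitmx -> GLval (toGL A) = A.
Proof. by move=> A_unit; apply: insubdK. Qed.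

Lemma GLvalK : cancel (@GLval 4 K) toGL.
Proof. by move=> g; apply: val_inj; apply: toGLE; apply: (valP g). Qed.

Definition class A : coset_of (scalars K) := coset (scalars K) (toGL A).

Lemma classM A B : A \in unitmx -> B \in unitmx ->
  class (A *m B) = (class A * class B)%g.
Proof.
move=> Au Bu; rewrite /class -morphM ?norm_scalars ?inE //; congr coset.
apply: val_inj; change (GLval (toGL (A *m B)) = GLval (toGL A * toGL B)%g).
by rewrite GL_ME !toGLE // unitmx_mul Au.
Qed.

Lemma class1 : class 1%:M = 1%g.
Proof.
(* An idempotent of a group is its identity. *)
have : (class 1%:M * class 1%:M = class 1%:M * 1)%g.
  by rewrite -classM ?unitmx1 // mulmx1 mulg1.
by move/mulgI.
Qed.

Lemma class_eq1 A : A \in unitmx -> class A = 1%g -> is_scalar_mx A.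
Proof.
move=> Au /coset_idr; rewrite norm_scalars inE => /(_ isT).
by rewrite inE toGLE.
Qed.

Lemma class_scale (a : K) A : a != 0 -> A \in unitmx -> class (a *: A) = class A.
Proof.
move=> a0 Au; rewrite -mul_scalar_mx classM //; last first.
  by rewrite -scalemx1 unitmxZ ?unitfE // unitmx1.
rewrite -[RHS]mul1g; congr (_ * _)%g; apply: coset_id.
rewrite inE toGLE ?scalar_mx_is_scalar //.
by rewrite -scalemx1 unitmxZ ?unitfE // unitmx1.
Qed.

Lemma lift0_mxM (A B : 'M[K]_3) : lift0_mx (A *m B) = lift0_mx A *m lift0_mx B.
Proof.
by rewrite /lift0_mx mulmx_block !(mul0mx, mulmx0, mul1mx, mulmx1, addr0, add0r).
Qed.

Lemma lift0_unitmx (A : 'M[K]_3) : (lift0_mx A \in unitmx) = (A \in unitmx).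
Proof. by rewrite !unitmxE /lift0_mx det_ublock det1 mul1r. Qed.

Definition class3 (A : 'M[K]_3) := class (lift0_mx A).

Lemma class3M (A B : 'M[K]_3) : A \in unitmx -> B \in unitmx ->
  class3 (A *m B) = (class3 A * class3 B)%g.
Proof. by move=> Au Bu; rewrite /class3 lift0_mxM classM ?lift0_unitmx. Qed.

Lemma class3_1 : class3 1%:M = 1%g.
Proof.
rewrite -class1 /class3; congr class.
by rewrite /lift0_mx -[1 in LHS]/(1%:M) -scalar_mx_block.
Qed.

(** The corner entry [1] of [lift0_mx A] forces the scalar to be [1]. Hence distinct invertible
    blocks have distinct classes, and blocks can be counted instead of classes. *)
Lemma class3_eq1 (A : 'M[K]_3) : A \in unitmx -> class3 A = 1%g -> A = 1%:M.
Proof.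
rewrite -lift0_unitmx => Au /(class_eq1 Au)/is_scalar_mxP[a].
rewrite (@scalar_mx_block _ 1 3) => /(@eq_block_mx _ 1 3 1 3)[e1 _ _ ->].
have -> : a = 1 by move/matrixP/(_ 0 0): e1; rewrite !mxE.
by [].
Qed.

Lemma class3_inj (A B : 'M[K]_3) : A \in unitmx -> B \in unitmx ->
  class3 A = class3 B -> A = B.
Proof.
move=> Au Bu e; apply: (can_inj (mulmxK (_ : invmx B \in unitmx))).
  by rewrite unitmx_inv.
rewrite mulmxV //; apply: class3_eq1.
  by rewrite unitmx_mul Au unitmx_inv.
by rewrite class3M ?unitmx_inv // e -class3M ?unitmx_inv // mulmxV // class3_1.
Qed.

End ClassOfMatrix.

Lemma simil_unit t : simil t -> mx3 t \in unitmx.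
Proof. by case/similP=> mu mu0 /(simil_unitmx mu0). Qed.

Lemma stabN_curve_stab L C t : stabN L C t ->
  toGL (lift0_mx (mx3 t)) \in curve_stab Q_Dege (cubic_form L C).
Proof.
case/and3P=> st /eqP eL /eqP eC; rewrite inE; apply/asboolP.
rewrite toGLE ?lift0_unitmx ?simil_unit //; split.
  have [mu mu0 e] := similP _ st; exists mu => //.
  rewrite sym_coef_mx_block.
  change ((lift0_mx (mx3 t))^T *m block_mx (0 : 'M_1) 0 0 phi3
    *m lift0_mx (mx3 t) = mu *: block_mx (0 : 'M_1) 0 0 phi3).
  rewrite /lift0_mx tr_block_mx !mulmx_block scale_block_mx !trmx0.
  by rewrite !(mul0mx, mulmx0, mul1mx, mulmx1, addr0, add0r, scaler0) e.
(* As [x^3] is fixed, the factor [r] is [1]. *)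
by exists 1; rewrite ?oner_neq0 // scale1r act_mpoly_cubic_form; apply: cubic_form_images.
Qed.

(** * Shape of the elements of the stabiliser *)

Definition point (x : F) (p : vec F) (i : 'I_4) : F :=
  if split (i : 'I_(1 + 3)) is inr k then coord p k else x.

Lemma point_lshift x p (i : 'I_1) : point x p (lshift 3 i) = x.
Proof. by rewrite /point; case: split_ordP => k // /eqP; rewrite eq_shift. Qed.

Lemma point_rshift x p (k : 'I_3) : point x p (rshift 1 k) = coord p k.
Proof.
by rewrite /point; case: split_ordP => j /eqP; rewrite eq_shift => // /eqP ->.
Qed.

Lemma mapv_vars (f : MP -> F) x p :
  (forall i, f 'X_i = point x p i) -> mapv f vars = p.
Proof.
move=> fE; rewrite /mapv /vars /= !fE.
rewrite (_ : @Ordinal 4 1 isT = rshift 1 v0); last exact: val_inj.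
rewrite (_ : @Ordinal 4 2 isT = rshift 1 v1); last exact: val_inj.
rewrite (_ : @Ordinal 4 3 isT = rshift 1 v2); last exact: val_inj.
by rewrite !point_rshift -!surjective_pairing.
Qed.

Lemma meval_cubic_form L C x p :
  (cubic_form L C).@[point x p] = x ^+ 3 + x * qeval L p + ceval C p.
Proof.
pose f : {rmorphism MP -> F} := meval (point x p).
have fX i : f 'X_i = point x p i by exact: mevalXU.
have fX0 : f X0 = x.
  rewrite fX (_ : @Ordinal 4 0 isT = lshift 3 (ord0 : 'I_1)) ?point_lshift //.
  exact: val_inj.
rewrite -[LHS]/(f _) /cubic_form !(rmorphD, rmorphM, rmorphXn) rmorph_qeval rmorph_ceval.
by rewrite (mapv_vars fX) fX0.
Qed.

Lemma meval_Q_Dege x p : Q_Dege.@[point x p] = bil p p.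
Proof.
pose f : {rmorphism MP -> F} := meval (point x p).
have fX i : f 'X_i = point x p i by exact: mevalXU.
have fvars := mapv_vars fX.
have fy : f vars.1.1 = p.1.1 by rewrite -[in RHS]fvars.
have fz : f vars.1.2 = p.1.2 by rewrite -[in RHS]fvars.
have fw : f vars.2 = p.2 by rewrite -[in RHS]fvars.
rewrite -[LHS]/(f _) Q_DegeE rmorphD rmorphM rmorph_nat rmorphM rmorphXn.
by rewrite fy fz fw /bil; ring.
Qed.

Lemma meval_act_mpoly a (b : 'rV[F]_3) (B : 'M_3) P x p :
  (act_mpoly (block_mx a%:M b 0 B : 'M_(1 + 3)) P).@[point x p] =
  P.@[point (a * x + (b 0 v0 * p.1.1 + (b 0 v1 * p.1.2 + b 0 v2 * p.2)))
            (applyF B p)].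
Proof.
rewrite /act_mpoly comp_mpoly_meval; apply: meval_eq => i.
rewrite tnth_mktuple rmorph_sum /=.
under eq_bigr do rewrite mevalZ mevalXU.
rewrite (@big_split_ord _ _ _ 1 3) /= big_ord1 sum_ord3 !point_rshift point_lshift /=.
rewrite -[i](@splitK 1 3); case: (split _) => k /=.
  rewrite !ord1 point_lshift !(@block_mxEur _ 1 3 1 3) (@block_mxEul _ 1 3 1 3).
  by rewrite mxE eqxx mulr1n.
rewrite point_rshift !(@block_mxEdr _ 1 3 1 3) (@block_mxEdl _ 1 3 1 3) mxE mul0r add0r.
by move: k; apply: forall_ord3.
Qed.

(* The coefficients are second and third differences of the values at
   [x = -1, 0, 1, 2]. *)
Lemma cubic_coefs (a r beta l c l' c' : F) :
  a != 0 ->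
  (forall x, (a * x + beta) ^+ 3 + (a * x + beta) * l + c =
             r * (x ^+ 3 + x * l' + c')) ->
  [/\ beta = 0, a ^+ 3 = r, a * l = r * l' & c = r * c'].
Proof.
move=> a0 E; have six : 6%:R != 0 :> F by [].
have beta0 : beta = 0.
  have : 6%:R * a ^+ 2 * beta = 0.
    have -> : 6%:R * a ^+ 2 * beta =
       ((a * 1 + beta) ^+ 3 + (a * 1 + beta) * l + c) +
       ((a * -1 + beta) ^+ 3 + (a * -1 + beta) * l + c) -
       2%:R * ((a * 0 + beta) ^+ 3 + (a * 0 + beta) * l + c) by ring.
    by rewrite !E; ring.
  have nz : 6%:R * a ^+ 2 != 0 by rewrite mulf_neq0 ?expf_neq0.
  by move/eqP; rewrite mulf_eq0 (negPf nz) => /eqP.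
have cE : c = r * c' by have := E 0; rewrite beta0 => e; ring: e.
have ar : a ^+ 3 = r.
  apply: (mulfI six); have := E 2%:R; have := E 1.
  rewrite beta0 cE => e1 e2.
  have -> : 6%:R * a ^+ 3 =
     ((a * 2%:R + 0) ^+ 3 + (a * 2%:R + 0) * l + r * c')
     - 2%:R * ((a * 1 + 0) ^+ 3 + (a * 1 + 0) * l + r * c') + r * c' by ring.
  by rewrite e1 e2; ring.
split=> //; have := E 1; rewrite beta0 cE -ar => e.
have -> : a * l = ((a * 1 + 0) ^+ 3 + (a * 1 + 0) * l + a ^+ 3 * c') - a ^+ 3 - a ^+ 3 * c' by ring.
by rewrite e; ring.
Qed.

Definition scalev (s : F) (v : vec F) := mapv ( *%R s) v.

Lemma qeval_scale f s v : qeval f (scalev s v) = s ^+ 2 * qeval f v.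
Proof.
rewrite /qeval mulr_sumr; apply: eq_bigr => m _.
by rewrite !coord_mapv; ring.
Qed.

Lemma ceval_scale f s v : ceval f (scalev s v) = s ^+ 3 * ceval f v.
Proof.
rewrite /ceval mulr_sumr; apply: eq_bigr => m _.
by rewrite !coord_mapv; ring.
Qed.

Lemma applyF_scale s B p : applyF (s *: B) p = scalev s (applyF B p).
Proof. by rewrite /applyF /scalev /mapv /= !mxE; congr (_, _, _); ring. Qed.

Lemma curve_stab_block L C g : g \in curve_stab Q_Dege (cubic_form L C) ->
  exists a (B : 'M[F]_3),
  [/\ a != 0, GLval g = a *: lift0_mx B,
     exists2 mu, mu != 0 & B^T *m phi3 *m B = mu *: phi3
   & forall p, bil p p = 0 ->
       qeval L (applyF B p) = qeval L p /\ ceval C (applyF B p) = ceval C p].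
Proof.
rewrite inE => /asboolP[[mu mu0 eM] [r r0 [H eP]]].
have Mu : (GLval g : 'M_(1 + 3)) \in unitmx by exact: (valP g).
move: {g} (GLval g : 'M_(1 + 3)) => M in Mu eM eP *.
rewrite -(submxK M) in Mu eM eP *.
move: (ulsubmx M) (ursubmx M) (dlsubmx M) (drsubmx M) => a0 b u B in Mu eM eP *.
rewrite (mx11_scalar a0) in Mu eM eP *; move: (a0 0 0) => {a0} a in Mu eM eP *.
have {eM}[euB eB] : B^T *m phi3 *m u = 0 /\ B^T *m phi3 *m B = mu *: phi3.
  rewrite sym_coef_mx_block in eM.
  have := eM : (block_mx a%:M b u B)^T *m block_mx (0 : 'M_1) 0 0 phi3
    *m block_mx a%:M b u B = mu *: block_mx (0 : 'M_1) 0 0 phi3.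
  rewrite tr_block_mx.
  rewrite !mulmx_block scale_block_mx !(mul0mx, mulmx0, addr0, add0r, scaler0).
  by case/eq_block_mx.
have Bu := simil_unitmx mu0 eB.
(* The lower left block of the similitude equation is [B^T phi3 u = 0], and [B^T phi3] is
   invertible. *)
have u0 : u = 0.
  have BphiU : B^T *m phi3 \in unitmx by rewrite unitmx_mul unitmx_tr Bu phi3_unit.
  by rewrite -(mulKmx BphiU u) euB mulmx0.
rewrite {}u0 {euB} in Mu eP *.
have a0 : a != 0.
  by move: Mu; rewrite unitmxE det_ublock unitrM det_scalar1 unitfE => /andP[].
pose beta p := b 0 v0 * p.1.1 + (b 0 v1 * p.1.2 + b 0 v2 * p.2).
(* Over an isotropic [p] the multiple of [Q] vanishes for every [x], which leaves an identity
   between two cubic polynomials in [x]. *)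
have key p : bil p p = 0 -> [/\ beta p = 0, a ^+ 3 = r,
    a * qeval L (applyF B p) = r * qeval L p & ceval C (applyF B p) = r * ceval C p].
  move=> p0; apply: cubic_coefs => // x.
  have /eqP := congr1 (meval (point x p)) eP.
  rewrite mevalB mevalM meval_Q_Dege p0 mulr0 subr_eq0 meval_act_mpoly mevalZ.
  by rewrite !meval_cubic_form => /eqP.
(* Three isotropic vectors spanning the space are enough to kill the linear form [beta]; the third
   is isotropic because [2 * 5 + 1 = 11]. *)
have [b0 ar _ _] := key (1, 0, 0) ltac:(by rewrite /bil /=; ring).
have [b2 _ _ _] := key (0, 0, 1) ltac:(by rewrite /bil /=; ring).
have [b1 _ _ _] := key (1, 1, 5%:R) ltac:(exact: val_inj).
have {b0 b1 b2}b0 : b = 0.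
  move: b0 b1 b2; rewrite /beta /= !(mulr0, mulr1, addr0, add0r) => e0 + e2.
  rewrite e0 e2 mul0r addr0 add0r => e1.
  by apply/rowP; apply: forall_ord3; rewrite mxE.
rewrite {}b0 in Mu eP beta key *; exists a, (a^-1 *: B); split=> //.
- by rewrite /lift0_mx scale_block_mx scalerA divff // scale1r !scaler0 scale_scalar_mx mulr1.
- exists (a^-1 * (a^-1 * mu)); first by rewrite !mulf_neq0 ?invr_neq0.
  by rewrite [(a^-1 *: B)^T]linearZ /= -!scalemxAl -scalemxAr eB !scalerA mulrA.
(* By homogeneity of degrees 2 and 3, dividing [B] by [a] cancels the factors, since [r = a^3]. *)
move=> p p0; have [_ _ eL eC] := key p p0.
rewrite applyF_scale qeval_scale ceval_scale eC -ar; split.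
  apply: (mulfI a0); rewrite mulrCA eL -ar mulrA; congr (_ * _).
  by field.
by rewrite mulrA; field.
Qed.

Definition tableN (B : 'M[F]_3) : matN :=
  (mapv toN (colv B v0), mapv toN (colv B v1), mapv toN (colv B v2)).

Lemma coord_tableN B (j : 'I_3) : coord (tableN B) j = mapv toN (colv B j).
Proof. by move: j; apply: forall_ord3. Qed.

Lemma mx3_tableN B : mx3 (tableN B) = B.
Proof.
apply/matrixP=> i j; rewrite mxE coord_tableN coord_mapv toNK.
by move: i; apply: forall_ord3.
Qed.

Lemma mem_digits a : toN a \in digits.
Proof.
have : (val a < 11)%N by case: a.
by rewrite /toN; move: (val a) => k; do 11![case: k => [//|k]].
Qed.

(** * Completeness of the enumeration *)

Lemma eq_qevalN f u v : (qevalN f u == qevalN f v) =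
  (qeval f (mapv (ofN F) u) == qeval f (mapv (ofN F) v)).
Proof. by rewrite -!ofN_qeval -eq_ofN /qevalN !red_red. Qed.

Lemma eq_cevalN f u v : (cevalN f u == cevalN f v) =
  (ceval f (mapv (ofN F) u) == ceval f (mapv (ofN F) v)).
Proof. by rewrite -!ofN_ceval -eq_ofN /cevalN !red_red. Qed.

Lemma bil_applyF (B : 'M[F]_3) mu p q : B^T *m phi3 *m B = mu *: phi3 ->
  bil (applyF B p) (applyF B q) = mu * bil p q.
Proof.
move=> e.
have E (i j : 'I_3) : bil (colv B i) (colv B j) = mu * phi3 i j.
  by rewrite -conj_phi3 e mxE.
have -> : bil (applyF B p) (applyF B q) =
  p.1.1 * q.1.1 * bil (colv B v0) (colv B v0) +
  p.1.1 * q.1.2 * bil (colv B v0) (colv B v1) +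
  p.1.1 * q.2 * bil (colv B v0) (colv B v2) +
  p.1.2 * q.1.1 * bil (colv B v1) (colv B v0) +
  p.1.2 * q.1.2 * bil (colv B v1) (colv B v1) +
  p.1.2 * q.2 * bil (colv B v1) (colv B v2) +
  p.2 * q.1.1 * bil (colv B v2) (colv B v0) +
  p.2 * q.1.2 * bil (colv B v2) (colv B v1) +
  p.2 * q.2 * bil (colv B v2) (colv B v2).
  by rewrite /bil /applyF /colv /=; ring.
by rewrite !E !phi3E /= /bil; ring.
Qed.

Lemma conic_isotropic p : p \in conic -> bil (mapv (ofN F) p) (mapv (ofN F) p) = 0.
Proof.
have /allP H : all (fun p => bilN p p == 0%num) conic by vm_compute.
by move/H; rewrite bilN_eq0 => /eqP.
Qed.

Section Completeness.
Variables (L : qform) (C : cform) (B : 'M[F]_3) (mu : F).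
Hypothesis mu_neq0 : mu != 0.
Hypothesis B_form : B^T *m phi3 *m B = mu *: phi3.
Hypothesis B_conic : forall p, bil p p = 0 ->
  qeval L (applyF B p) = qeval L p /\ ceval C (applyF B p) = ceval C p.

Lemma mem_fiber p : p \in conic ->
  mapv toN (applyF B (mapv (ofN F) p)) \in fiber L C p.
Proof.
move=> /conic_isotropic p0; have [eL eC] := B_conic p0.
rewrite mem_filter eq_qevalN eq_cevalN !mapv_toNK eL eC !eqxx !andTb.
rewrite mem_filter bilN_eq0 !mapv_toNK (bil_applyF _ _ B_form) p0 mulr0 eqxx andTb.
by apply: allpairs_f (mem_digits _); apply: allpairs_f; exact: mem_digits.
Qed.

Lemma of_three_imagesE :
  of_three_images (mapv toN (colv B v0)) (mapv toN (applyF B (1, 1, 5%:R)))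
           (mapv toN (colv B v2)) = tableN B.
Proof.
rewrite /of_three_images /tableN; congr (_, _, _).
have E x a b : red (toN x + (10 * toN a + 6 * toN b))%num = toN (x - a - 5%:R * b).
  apply/eqP; rewrite -[toN (_ - _)]red_toN eq_ofN !(ofND, ofNM) !toNK.
  have -> : ofN F 10 = -1 by exact: val_inj.
  have -> : ofN F 6 = - 5%:R by exact: val_inj.
  by apply/eqP; ring.
rewrite /mapv /applyF /colv; cbn [fst snd]; rewrite !E.
by congr (toN _, toN _, toN _); ring.
Qed.

(** The hypotheses of the section are what [curve_stab_block] provides, so the enumeration misses no
    element of the stabiliser. *)
Lemma tableN_candidates : tableN B \in candidates L C.
Proof.
have c0 : applyF B (mapv (ofN F) (1, 0, 0)%num) = colv B v0.
  rewrite (_ : mapv _ _ = (1, 0, 0)); last by congr (_, _, _); apply: val_inj.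
  rewrite /applyF /colv; cbn [fst snd].
  by rewrite !(mulr0, mulr1, addr0).
have c2 : applyF B (mapv (ofN F) (0, 0, 1)%num) = colv B v2.
  rewrite (_ : mapv _ _ = (0, 0, 1)); last by congr (_, _, _); apply: val_inj.
  rewrite /applyF /colv; cbn [fst snd].
  by rewrite !(mulr0, mulr1, add0r).
rewrite mem_filter; apply/andP; split.
  rewrite /keeps_valuesN; apply/andP; split.
    by apply/similP; exists mu; rewrite ?mx3_tableN.
  apply/allP=> p /conic_isotropic p0; have [eL eC] := B_conic p0.
  by rewrite eq_qevalN eq_cevalN ofN_applyN mx3_tableN eL eC !eqxx.
apply/flatten_mapP; exists (mapv toN (colv B v0), mapv toN (colv B v2)).
  rewrite mem_filter bilN_eq0 !mapv_toNK -conj_phi3 B_form !mxE mulr1 mu_neq0 andTb.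
  by apply: allpairs_f; rewrite -?c0 -?c2; apply: mem_fiber; vm_compute.
apply/mapP; exists (mapv toN (applyF B (1, 1, 5%:R))); last by rewrite of_three_imagesE.
exact: (@mem_fiber (1, 1, 5)%num).
Qed.

End Completeness.

(** * Groups of classes *)

Lemma simil_mul s t : simil s -> simil t -> simil (mulN s t).
Proof.
case/similP=> mu mu0 e /similP[nu nu0 e']; apply/similP; exists (mu * nu).
  by rewrite mulf_neq0.
rewrite mx3_mul trmx_mul -!mulmxA (mulmxA phi3) (mulmxA (mx3 s)^T).
by rewrite (mulmxA (mx3 s)^T) e -scalemxAl -scalemxAr mulmxA e' scalerA.
Qed.

Lemma simil1 : simil oneN.
Proof. by vm_compute. Qed.

Lemma canonical_mul s t : canonical (mulN s t).
Proof. by rewrite /canonical /mulN /applyN /dotN /mapv /= !red_red. Qed.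

Lemma mx3_inj s t : canonical s -> canonical t -> mx3 s = mx3 t -> s = t.
Proof.
move=> /eqP <- /eqP <- /matrixP e.
have {}e (i j : 'I_3) : red (coord (coord s j) i) = red (coord (coord t j) i).
  by apply/eqP; rewrite eq_ofN; have := e i j; rewrite !mxE !coord_mapv !ofN_red ?F11_eq0 // => ->.
rewrite /mapv; congr (_, _, _); congr (_, _, _).
all: first [exact: (e v0 v0)|exact: (e v1 v0)|exact: (e v2 v0)
  |exact: (e v0 v1)|exact: (e v1 v1)|exact: (e v2 v1)
  |exact: (e v0 v2)|exact: (e v1 v2)|exact: (e v2 v2)].
Qed.

Definition cl (t : matN) : coset_of (scalars F) := class3 (mx3 t).

Lemma clM s t : simil s -> simil t -> cl (mulN s t) = (cl s * cl t)%g.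
Proof. by move=> ss st; rewrite /cl mx3_mul class3M ?simil_unit. Qed.

Lemma cl1 : cl oneN = 1%g.
Proof. by rewrite /cl mx3_1 class3_1. Qed.

Lemma cl_inj s t : simil s -> simil t -> canonical s -> canonical t ->
  cl s = cl t -> s = t.
Proof.
move=> ss st cs ct e.
exact: mx3_inj cs ct (class3_inj (simil_unit ss) (simil_unit st) e).
Qed.

(** Each round only multiplies by generators, so no class outside the generated subgroup appears,
    whatever the number of rounds. *)
Lemma iter_stepP gs k t : all simil gs -> t \in iter k (step gs) [:: oneN] ->
  simil t && (cl t \in <<[set:: map cl gs]>>%g).
Proof.
move=> /allP sgs; elim: k t => [|k IH] t.
  by rewrite mem_seq1 => /eqP ->; rewrite simil1 cl1 group1.
rewrite iterS mem_undup mem_cat => /orP[/IH //|].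
case/allpairsP=> -[g u] /= [g_gs /IH /andP[su clu] ->].
have sg := sgs g g_gs; rewrite (simil_mul sg su) (clM sg su) andTb.
apply: groupM clu; apply: mem_gen; rewrite inE; exact: map_f.
Qed.

Lemma uniq_generated gs : uniq (generated gs).
Proof. exact: undup_uniq. Qed.

Lemma curve_aut_generated L C gs n (A := curve_aut Q_Dege (cubic_form L C)) :
  stabiliser_check L C gs n ->
  [/\ all simil gs, #|A| = n & A = <<[set:: map cl gs]>>%g].
Proof.
case/and5P=> /eqP sz one_s /allP gs_s /allP st_s.
case/and3P=> /allP can_s /allP mul_s /allP cand_s.
set s := generated gs in sz one_s gs_s st_s can_s mul_s cand_s.
have sim_s t : t \in s -> simil t by case/st_s/and3P.
have mulP t u : t \in s -> u \in s -> mulN t u \in s by move/mul_s/allP; apply.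
(* From left to right, the scalar [a] is divided out and the block is found among the candidates;
   from right to left, the normal forms have been checked. *)
have AE : A =i map cl s.
  move=> x; rewrite /A curve_autE; apply/imsetP/mapP=> [[g] | [t ts ->]].
    case/curve_stab_block=> a [B [a0 gE [mu mu0 eB] vB]] ->.
    have ts := cand_s _ (tableN_candidates mu0 eB vB).
    exists (tableN B) => //; rewrite -(GLvalK g) gE /cl mx3_tableN.
    by apply: class_scale; rewrite // lift0_unitmx (simil_unitmx mu0 eB).
  by exists (toGL (lift0_mx (mx3 t))) => //; apply/stabN_curve_stab/st_s.
(* The group structure gives the inclusion of the generated subgroup in [A] from that of the
   generators alone. *)
have A_group : group_set A.
  apply/group_setP; split; first by rewrite AE -cl1 map_f.
  move=> x y; rewrite !AE => /mapP[t ts ->] /mapP[u us ->].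
  rewrite -(clM (sim_s t ts) (sim_s u us)); exact/map_f/mulP.
have sgs : all simil gs by apply/allP=> g /gs_s; apply: sim_s.
split=> //.
  (* The list has no duplicates and [cl] is injective on reduced similitudes, so its length counts
     the classes. *)
  rewrite (eq_card AE) -sz -(size_map cl s); apply/card_uniqP.
  rewrite map_inj_in_uniq; first exact: uniq_generated.
  move=> t u ts us.
  exact: cl_inj (sim_s t ts) (sim_s u us) (can_s t ts) (can_s u us).
apply/eqP; rewrite eqEsubset; apply/andP; split.
  apply/subsetP=> x; rewrite AE => /mapP[t ts ->].
  by case/andP: (iter_stepP sgs ts).
rewrite -[A]/(gval (Group A_group)) gen_subG; apply/subsetP=> x.
by rewrite inE => /mapP[g /gs_s gs_g ->]; rewrite AE map_f.
Qed.

Lemma order_cl t k : simil t -> orderN t k -> #[cl t]%g = k.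
Proof.
move=> st /and3P[k_gt0 /eqP tk /allP t_lt].
have powP j : simil (powN t j) && (cl (powN t j) == cl t ^+ j)%g.
  elim: j => [|j /andP[IH1 /eqP IH2]]; first by rewrite simil1 cl1 eqxx.
  by rewrite /powN iterS simil_mul // clM // IH2 expgS eqxx.
have clX j : (cl t ^+ j)%g = cl (powN t j) by have /andP[_ /eqP] := powP j.
have dk : (#[cl t]%g %| k)%N by rewrite order_dvdn clX tk cl1.
(* If the order were smaller than [k], the corresponding power of the table would equal [oneN] by
   injectivity of [cl], against the check of the intermediate powers. *)
apply/eqP; rewrite eqn_leq dvdn_leq //= leqNgt; apply/negP=> lt_k.
have o_gt0 := order_gt0 (cl t); have clo := clX #[cl t]%g.
have s_o : simil (powN t #[cl t]%g) by have /andP[] := powP #[cl t]%g.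
(* The exponent is positive, so the power is the result of a multiplication and hence reduced. *)
have c_o : canonical (powN t #[cl t]%g) by rewrite -(prednK o_gt0) canonical_mul.
have /t_lt/eqP[] : #[cl t]%g \in iota 1 k.-1.
  by rewrite mem_iota o_gt0 add1n prednK.
apply: cl_inj s_o simil1 c_o _ _; first by vm_compute.
by rewrite -clo expg_order cl1.
Qed.

(** The entries come row by row as field elements, so that the displayed matrices, including those
    with [-1], unify directly; they are stored by columns. *)
Definition matN_of (a b c d e f g h i : F) : matN :=
  mapv (mapv toN) ((a, d, g), (b, e, h), (c, f, i)).

Lemma represents_cl (a b c d e f g h i : F) (t := matN_of a b c d e f g h i) :
  simil t -> represents (mx4 [:: [:: 1; 0; 0; 0]; [:: 0; a; b; c];
                                 [:: 0; d; e; f]; [:: 0; g; h; i]]) (cl t).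
Proof.
move=> st; exists (toGL (lift0_mx (mx3 t))) => //.
rewrite toGLE ?lift0_unitmx ?simil_unit //.
have -> : mx3 t = \matrix_(i', j')
    (nth [::] [:: [:: a; b; c]; [:: d; e; f]; [:: g; h; i]] i')`_j'.
  apply/matrixP=> i' j'; rewrite !mxE !coord_mapv toNK; move: i' j'.
  by apply: forall_ord3; apply: forall_ord3.
apply/matrixP=> i' j'; rewrite /lift0_mx /block_mx !mxE.
case: split_ordP => i1 ->; rewrite !mxE; case: split_ordP => j1 ->; rewrite !mxE //.
- by rewrite !ord1.
- by rewrite !ord1; move: j1; apply: forall_ord3.
- by rewrite !ord1; move: i1; apply: forall_ord3.
- by move: i1 j1; apply: forall_ord3; apply: forall_ord3.
Qed.

(** * The seventeen curves *)

Definition quadratic_part (i : nat) : qform :=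
  match i with
  | 4 => [:: (1%num, 2, 2)]
  | 5 => [:: (2%num, 2, 2)]
  | 6 => [:: (1%num, 1, 2)]
  | 7 => [:: (1%num, 2, 2); (1%num, 0, 1)]
  | 8 => [:: (6%num, 2, 2); (1%num, 0, 1)]
  | 14 => [:: (1%num, 0, 0); (7%num, 0, 1); (8%num, 1, 1); (8%num, 1, 2);
              (2%num, 2, 2)]
  | _ => [::]
  end%N.

Definition cubic_part (i : nat) : cform :=
  match i with
  | 1 => [:: (1%num, 0, 0, 0); (1%num, 2, 2, 2)]
  | 2 => [:: (1%num, 0, 0, 0); (2%num, 2, 2, 2)]
  | 3 => [:: (1%num, 0, 0, 0); (1%num, 1, 1, 1); (5%num, 2, 2, 2)]
  | 4 | 5 => [:: (1%num, 0, 0, 0)]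
  | 6 => [:: (1%num, 0, 0, 0); (7%num, 1, 1, 1); (1%num, 2, 2, 2)]
  | 7 => [:: (1%num, 0, 0, 0); (5%num, 1, 1, 1); (4%num, 2, 2, 2)]
  | 8 => [:: (1%num, 0, 0, 0); (8%num, 1, 1, 1); (8%num, 2, 2, 2)]
  | 9 => [:: (5%num, 0, 0, 0); (2%num, 0, 1, 1); (1%num, 1, 1, 1);
             (1%num, 1, 2, 2); (4%num, 2, 2, 2)]
  | 10 => [:: (1%num, 0, 0, 0); (8%num, 0, 1, 1); (1%num, 1, 1, 2);
              (2%num, 2, 2, 2)]
  | 11 => [:: (2%num, 0, 0, 0); (2%num, 0, 1, 1); (4%num, 1, 1, 1);
              (1%num, 1, 1, 2); (3%num, 2, 2, 2)]
  | 12 => [:: (2%num, 0, 0, 0); (4%num, 0, 1, 1); (1%num, 1, 1, 2);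
              (10%num, 2, 2, 2)]
  | 13 | 14 => [:: (2%num, 0, 0, 0); (4%num, 0, 1, 1); (1%num, 1, 1, 1);
              (1%num, 1, 1, 2); (1%num, 1, 2, 2); (7%num, 2, 2, 2)]
  | 15 => [:: (5%num, 0, 0, 0); (3%num, 0, 1, 1); (5%num, 1, 1, 1);
              (1%num, 1, 1, 2); (1%num, 1, 2, 2); (10%num, 2, 2, 2)]
  | 16 => [:: (6%num, 0, 0, 0); (2%num, 0, 1, 1); (6%num, 1, 1, 1);
              (1%num, 1, 1, 2); (1%num, 1, 2, 2); (6%num, 2, 2, 2)]
  | 17 => [:: (10%num, 0, 0, 0); (6%num, 0, 1, 1); (7%num, 1, 1, 1);
              (1%num, 1, 1, 2); (1%num, 1, 2, 2)]
  | _ => [::]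
  end%N.

Lemma P_DegeE i : (0 < i <= 17)%N ->
  P_Dege i = cubic_form (quadratic_part i) (cubic_part i).
Proof.
case/andP; case: i => // i _; rewrite /cubic_form /X0 /vars.
(* For each curve the four indeterminates are generalised to arbitrary ring elements, which leaves
   an identity for [ring]. *)
do 17?[case: i => [_|i]] => //; rewrite /P_Dege;
  move: ('X_(@Ordinal 4 0 isT) : MP) ('X_(@Ordinal 4 1 isT) : MP)
        ('X_(@Ordinal 4 2 isT) : MP) ('X_(@Ordinal 4 3 isT) : MP) => x y z w;
  rewrite /qeval /ceval /quadratic_part /cubic_part unlock /= ?scaler_nat
    /ofN /N.to_nat /PosDef.Pos.to_nat /=; ring.
Qed.

Lemma set_seq2 (T : finType) (x y : T) : [set:: [:: x; y]] = [set x; y].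
Proof. by apply/setP=> z; rewrite !inE. Qed.

Lemma set_seq1 (T : finType) (x : T) : [set:: [:: x]] = [set x].
Proof. by apply/setP=> z; rewrite !inE. Qed.

Lemma A_DegeE i n gs : (0 < i <= 17)%N ->
  stabiliser_check (quadratic_part i) (cubic_part i) gs n ->
  [/\ all simil gs, #|A_Dege i| = n & A_Dege i = <<[set:: map cl gs]>>%g].
Proof. by move=> i17; rewrite /A_Dege (P_DegeE i17); apply: curve_aut_generated. Qed.

Lemma card_A_Dege i n gs : (0 < i <= 17)%N ->
  stabiliser_check (quadratic_part i) (cubic_part i) gs n -> #|A_Dege i| = n.
Proof. by move=> i17 /(A_DegeE i17)[]. Qed.

Lemma A_Dege_one_generator i n (a b c d e f g h j : F)
    (t := matN_of a b c d e f g h j) :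
  (0 < i <= 17)%N ->
  stabiliser_check (quadratic_part i) (cubic_part i) [:: t] n ->
  #|A_Dege i| = n /\
  exists2 x : coset_of (scalars F),
    represents (mx4 [:: [:: 1; 0; 0; 0]; [:: 0; a; b; c];
                        [:: 0; d; e; f]; [:: 0; g; h; j]]) x
    & A_Dege i = <<[set x]>>%g.
Proof.
move=> i17 /(A_DegeE i17)[/andP[st _] -> ->]; split=> //.
exists (cl t); first exact: represents_cl.
by rewrite -set_seq1.
Qed.

Lemma A_Dege_two_generators i n k l (a b c d e f g h j a' b' c' d' e' f' g' h' j' : F)
    (t := matN_of a b c d e f g h j) (u := matN_of a' b' c' d' e' f' g' h' j') :
  (0 < i <= 17)%N ->
  [&& stabiliser_check (quadratic_part i) (cubic_part i) [:: t; u] n, orderN t k & orderN u l] ->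
  #|A_Dege i| = n /\
  exists x y : coset_of (scalars F),
    [/\ represents (mx4 [:: [:: 1; 0; 0; 0]; [:: 0; a; b; c];
                            [:: 0; d; e; f]; [:: 0; g; h; j]]) x,
        represents (mx4 [:: [:: 1; 0; 0; 0]; [:: 0; a'; b'; c'];
                            [:: 0; d'; e'; f']; [:: 0; g'; h'; j']]) y,
        A_Dege i = <<[set x; y]>>%g, #[x]%g = k & #[y]%g = l].
Proof.
move=> i17 /and3P[/(A_DegeE i17)[/and3P[st su _] -> ->] ot ou]; split=> //.
exists (cl t), (cl u); split; rewrite ?set_seq2.
- exact: represents_cl.
- exact: represents_cl.
- by rewrite -set_seq2.
- exact: order_cl.
- exact: order_cl.
Qed.

Theorem proposition4p3p3 :
  (#|A_Dege 1| = 4%N /\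
   exists a b : coset_of (scalars 'F_11),
     [/\ represents (mx4 [:: [:: 1; 0; 0; 0]; [:: 0; 1; 0; 0]; [:: 0; 0; -1; 0]; [:: 0; 0; 0; 1]]) a,
         represents (mx4 [:: [:: 1; 0; 0; 0]; [:: 0; 0; 0; 1]; [:: 0; 0; 1; 0]; [:: 0; 1; 0; 0]]) b,
         A_Dege 1 = <<[set a; b]>>%g,
         #[a]%g = 2%N & #[b]%g = 2%N])
  /\ (#|A_Dege 2| = 4%N /\
   exists a b : coset_of (scalars 'F_11),
     [/\ represents (mx4 [:: [:: 1; 0; 0; 0]; [:: 0; 1; 0; 0]; [:: 0; 0; -1; 0]; [:: 0; 0; 0; 1]]) a,
         represents (mx4 [:: [:: 1; 0; 0; 0]; [:: 0; 0; 0; 7]; [:: 0; 0; 1; 0]; [:: 0; 8; 0; 0]]) b,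
         A_Dege 2 = <<[set a; b]>>%g,
         #[a]%g = 2%N & #[b]%g = 2%N])
  /\ (#|A_Dege 3| = 4%N /\
   exists a b : coset_of (scalars 'F_11),
     [/\ represents (mx4 [:: [:: 1; 0; 0; 0]; [:: 0; 0; 0; 3]; [:: 0; 0; 1; 0]; [:: 0; 4; 0; 0]]) a,
         represents (mx4 [:: [:: 1; 0; 0; 0]; [:: 0; 7; 4; 2]; [:: 0; 5; 7; 4]; [:: 0; 10; 5; 7]]) b,
         A_Dege 3 = <<[set a; b]>>%g,
         #[a]%g = 2%N & #[b]%g = 2%N])
  /\ (#|A_Dege 4| = 2%N /\
   exists2 a : coset_of (scalars 'F_11),
     represents (mx4 [:: [:: 1; 0; 0; 0]; [:: 0; 1; 0; 0]; [:: 0; 0; -1; 0]; [:: 0; 0; 0; 1]]) a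
     & A_Dege 4 = <<[set a]>>%g)
  /\ (#|A_Dege 5| = 2%N /\
   exists2 a : coset_of (scalars 'F_11),
     represents (mx4 [:: [:: 1; 0; 0; 0]; [:: 0; 1; 0; 0]; [:: 0; 0; -1; 0]; [:: 0; 0; 0; 1]]) a
     & A_Dege 5 = <<[set a]>>%g)
  /\ #|A_Dege 6| = 1%N
  /\ (#|A_Dege 7| = 2%N /\
   exists2 a : coset_of (scalars 'F_11),
     represents (mx4 [:: [:: 1; 0; 0; 0]; [:: 0; 7; 1; 7]; [:: 0; 9; 7; 1]; [:: 0; 6; 9; 7]]) a
     & A_Dege 7 = <<[set a]>>%g)
  /\ #|A_Dege 8| = 1%N
  /\ (#|A_Dege 9| = 6%N /\
   exists2 a : coset_of (scalars 'F_11),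
     represents (mx4 [:: [:: 1; 0; 0; 0]; [:: 0; 6; 5; 8]; [:: 0; 3; 7; 3]; [:: 0; 2; 4; 7]]) a
     & A_Dege 9 = <<[set a]>>%g)
  /\ (#|A_Dege 10| = 12%N /\
   exists a b : coset_of (scalars 'F_11),
     [/\ represents (mx4 [:: [:: 1; 0; 0; 0]; [:: 0; 2; 9; 10]; [:: 0; 6; 6; 9]; [:: 0; 2; 6; 2]]) a,
         represents (mx4 [:: [:: 1; 0; 0; 0]; [:: 0; 2; 2; 10]; [:: 0; 6; 5; 9]; [:: 0; 2; 5; 2]]) b,
         A_Dege 10 = <<[set a; b]>>%g,
         #[a]%g = 2%N & #[b]%g = 6%N])
  /\ (#|A_Dege 11| = 12%N /\
   exists a b : coset_of (scalars 'F_11),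
     [/\ represents (mx4 [:: [:: 1; 0; 0; 0]; [:: 0; 7; 6; 10]; [:: 0; 8; 9; 6]; [:: 0; 8; 8; 7]]) a,
         represents (mx4 [:: [:: 1; 0; 0; 0]; [:: 0; 2; 1; 8]; [:: 0; 2; 0; 3]; [:: 0; 10; 6; 7]]) b,
         A_Dege 11 = <<[set a; b]>>%g,
         #[a]%g = 2%N & #[b]%g = 6%N])
  /\ (#|A_Dege 12| = 24%N /\
   exists a b : coset_of (scalars 'F_11),
     [/\ represents (mx4 [:: [:: 1; 0; 0; 0]; [:: 0; 1; 9; 9]; [:: 0; 8; 5; 4]; [:: 0; 1; 6; 4]]) a,
         represents (mx4 [:: [:: 1; 0; 0; 0]; [:: 0; 0; 0; 3]; [:: 0; 0; 1; 0]; [:: 0; 4; 0; 0]]) b,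
         A_Dege 12 = <<[set a; b]>>%g,
         #[a]%g = 4%N & #[b]%g = 2%N])
  /\ (#|A_Dege 13| = 4%N /\
   exists2 a : coset_of (scalars 'F_11),
     represents (mx4 [:: [:: 1; 0; 0; 0]; [:: 0; 9; 7; 4]; [:: 0; 1; 1; 0]; [:: 0; 3; 0; 0]]) a
     & A_Dege 13 = <<[set a]>>%g)
  /\ (#|A_Dege 14| = 2%N /\
   exists2 a : coset_of (scalars 'F_11),
     represents (mx4 [:: [:: 1; 0; 0; 0]; [:: 0; 1; 4; 3]; [:: 0; 10; 8; 4]; [:: 0; 5; 10; 1]]) a
     & A_Dege 14 = <<[set a]>>%g)
  /\ (#|A_Dege 15| = 6%N /\
   exists2 a : coset_of (scalars 'F_11),
     represents (mx4 [:: [:: 1; 0; 0; 0]; [:: 0; 8; 7; 10]; [:: 0; 5; 2; 3]; [:: 0; 6; 10; 10]]) a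
     & A_Dege 15 = <<[set a]>>%g)
  /\ (#|A_Dege 16| = 3%N /\
   exists2 a : coset_of (scalars 'F_11),
     represents (mx4 [:: [:: 1; 0; 0; 0]; [:: 0; 1; 8; 1]; [:: 0; 8; 10; 0]; [:: 0; 1; 0; 0]]) a
     & A_Dege 16 = <<[set a]>>%g)
  /\ (#|A_Dege 17| = 8%N /\
   exists a b : coset_of (scalars 'F_11),
     [/\ represents (mx4 [:: [:: 1; 0; 0; 0]; [:: 0; 3; 6; 5]; [:: 0; 2; 3; 9]; [:: 0; 3; 3; 4]]) a,
         represents (mx4 [:: [:: 1; 0; 0; 0]; [:: 0; 7; 2; 6]; [:: 0; 2; 9; 2]; [:: 0; 6; 2; 7]]) b,
         A_Dege 17 = <<[set a; b]>>%g,
         #[a]%g = 4%N & #[b]%g = 2%N]).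
Proof.
(* Unification reads the matrices off the goal, and [vm_compute] evaluates the certificate together
   with the orders of the two generators. *)
split; first by apply: A_Dege_two_generators; last vm_compute.
split; first by apply: A_Dege_two_generators; last vm_compute.
split; first by apply: A_Dege_two_generators; last vm_compute.
split; first by apply: A_Dege_one_generator; last vm_compute.
split; first by apply: A_Dege_one_generator; last vm_compute.
(* For a trivial group the list of generators is empty and its closure contains only the
   identity. *)
split; first by apply: (@card_A_Dege _ _ [::]); last vm_compute.
split; first by apply: A_Dege_one_generator; last vm_compute.
split; first by apply: (@card_A_Dege _ _ [::]); last vm_compute.
split; first by apply: A_Dege_one_generator; last vm_compute.
split; first by apply: A_Dege_two_generators; last vm_compute.
split; first by apply: A_Dege_two_generators; last vm_compute.
split; first by apply: A_Dege_two_generators; last vm_compute.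
split; first by apply: A_Dege_one_generator; last vm_compute.
split; first by apply: A_Dege_one_generator; last vm_compute.
split; first by apply: A_Dege_one_generator; last vm_compute.
split; first by apply: A_Dege_one_generator; last vm_compute.
by apply: A_Dege_two_generators; last vm_compute.
Qed.
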